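(* Let $I_n$ be the normal subgroup of $G_n$ generated by the involutions of $G_n$, and let $A:G_n\to\mathbb S_n$ be the morphism $A(f)=2\sum_{j=1}^n\alpha_j(f)$. (1) The kernel of $A$ coincides with $I_n$. (2) Any $f\in I_n$ can be written as the product of at most $4$ involutions of $G_n$. (3) For any $n\ge3$, there exists $f\in G_n$ which cannot be written as a product of $3$ involutions of $G_n$.
   Context: An interval exchange transformation (IET) is a bijection of $[0,1)$ defined by a finite partition of $[0,1)$ into half-open subintervals and a reordering of these intervals by translations. Let $n\ge1$, let $\mathcal S_n$ be the group of permutations of $\{1,\dots,n\}$, $\mathbb S_n=[0,\frac1n]/(0=\frac1n)\cong\mathbb R/\frac1n\mathbb Z$, and $I_i$-th interval $[\frac{i-1}{n},\frac in)$. $G_n$ is the group of IETs $g$ for which there are $\sigma_g\in\mathcal S_n$ and $\alpha_g=(\alpha_1(g),\dots,\alpha_n(g))\in\mathbb S_n^n$ such that $g$ maps $[\frac{i-1}{n},\frac in)$ onto $[\frac{\sigma_g(i)-1}{n},\frac{\sigma_g(i)}n)$ by translating the first interval to the second and then rotating by $\alpha_i(g)$ (mod $\frac1n$ inside the image interval). An involution is an element whose square is the identity. *)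

(* Defs.v *)
From HB Require Import structures.
From mathcomp Require Import all_boot all_order perm all_algebra.
From mathcomp Require Import ring lra zify.
From mathcomp Require Import boolp classical_sets reals.

Set Implicit Arguments.
Unset Strict Implicit.
Unset Printing Implicit Defensive.

Import Order.TTheory GRing.Theory Num.Theory.

Local Open Scope classical_set_scope.
Local Open Scope ring_scope.

(* The symmetric group of an arbitrary (possibly infinite) type. *)
Record sym (T : Type) := Sym {
  sym_fun :> T -> T;
  sym_inv : T -> T;
  sym_funK : cancel sym_fun sym_inv;
  sym_invK : cancel sym_inv sym_fun }.

Section SymGroup.
Variable T : Type.
Implicit Types f g h : sym T.

Lemma symP f g : f =1 g -> f = g.
Proof.
case: f g => [f f' fK f'K] [g g' gK g'K] /= /funext E; subst g.
have E' : f' = g' by apply/funext => x; rewrite -{1}(g'K x) fK.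
by subst g'; congr Sym; apply: Prop_irrelevance.
Qed.

HB.instance Definition _ := gen_eqMixin (sym T).
HB.instance Definition _ := gen_choiceMixin (sym T).

Definition sym_one := @Sym T id id (fun=> erefl) (fun=> erefl).
Definition sym_opp f := Sym (@sym_invK T f) (@sym_funK T f).
Definition sym_mul f g :=
  Sym (can_comp (@sym_funK T f) (@sym_funK T g))
      (can_comp (@sym_invK T g) (@sym_invK T f)).

Lemma sym_mulA : associative sym_mul. Proof. by move=> f g h; apply: symP. Qed.
Lemma sym_mul1g : left_id sym_one sym_mul.
Proof. by move=> f; apply: symP. Qed.
Lemma sym_mulg1 : right_id sym_one sym_mul.
Proof. by move=> f; apply: symP. Qed.
Lemma sym_mulVg : left_inverse sym_one sym_opp sym_mul.
Proof. by move=> f; apply: symP => x /=; rewrite sym_funK. Qed.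
Lemma sym_mulgV : right_inverse sym_one sym_opp sym_mul.
Proof. by move=> f; apply: symP => x /=; rewrite sym_invK. Qed.

HB.instance Definition _ := isGroup.Build (sym T)
  sym_mulA sym_mul1g sym_mulg1 sym_mulVg sym_mulgV.

End SymGroup.

Section Normal.
Variable gT : groupType.
Implicit Types (G H S : set gT).
Local Open Scope group_scope.

Definition subgroup H : Prop := group_closed (mem H).

Definition normal_in G H : Prop :=
  [/\ subgroup H, H `<=` G & forall g h, G g -> H h -> H (g * h * g^-1)].

(* The smallest normal subgroup of G containing S. *)
Definition normal_closure_in G S : set gT :=
  [set x | forall H, normal_in G H -> S `<=` H -> H x].

(* The identity counts as an involution. *)
Definition involutions G : set gT := [set x | G x /\ x * x = 1].

Definition prod_involutions G (k : nat) : set gT :=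
  [set x | exists t : 'I_k -> gT,
     (forall i, involutions G (t i)) /\ x = \prod_(i < k) t i].

End Normal.

(* The group (1/n)Z, and the circle R/(1/n)Z. *)
Section Circle.
Variables (R : realType) (n : nat).

Definition lattice : {pred R} :=
  fun x => `[< exists k : int, x = k%:~R / n%:R >].

Lemma lattice_zmod_closed : zmod_closed lattice.
Proof.
split; first by apply/asboolP; exists 0; rewrite mul0r.
move=> x y /asboolP[k ->] /asboolP[l ->]; apply/asboolP.
by exists (k - l); rewrite rmorphB /= mulrBl.
Qed.

HB.instance Definition _ :=
  GRing.isZmodClosed.Build R lattice lattice_zmod_closed.

Definition circle := {ideal_quot lattice}.

HB.instance Definition _ := GRing.Zmodule.on circle.

Definition to_circle (x : R) : circle := (\pi_({ideal_quot lattice}) x)%qT.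

Lemma to_circleD x y : to_circle (x + y) = to_circle x + to_circle y.
Proof. exact: (raddfD (\pi_({ideal_quot lattice}))%qT). Qed.

Lemma to_circle_eq x y :
  to_circle x = to_circle y <-> exists k : int, x - y = k%:~R / n%:R.
Proof.
split=> [/eqP|[k E]]; last apply/eqP.
  by rewrite -Quotient.idealrBE => /asboolP.
by rewrite -Quotient.idealrBE; apply/asboolP; exists k.
Qed.

Lemma to_circle_surj (a : circle) : exists x, to_circle x = a.
Proof. by exists (repr a); rewrite /to_circle reprK. Qed.

End Circle.

Section IET.
Variable R : realType.

Definition unit_co := {x : R | 0 <= x < 1}.
Implicit Types f g : sym unit_co.

(* The pieces are [t_k, t_(k+1)[ for k < m, and f translates each by c_k. *)
Definition is_iet f : Prop :=
  exists (m : nat) (t c : nat -> R),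
    [/\ t 0%N = 0, t m = 1, (forall k, (k < m)%N -> t k < t k.+1) &
        forall (k : nat) (x : unit_co), (k < m)%N ->
          t k <= val x < t k.+1 -> val (f x) = val x + c k].

Variable n : nat.

(* Indices start at 0: this is [i/n, (i+1)/n[ for i < n. *)
Definition subint (i : 'I_n) : set unit_co :=
  [set x | i%:R / n%:R <= val x < i.+1%:R / n%:R].

(* The position of f x in its interval is that of x, rotated by a i; as f x
   lies in subint (s i), the congruence modulo 1/n determines f x. *)
Definition rotates f (s : 'S_n) (a : {ffun 'I_n -> circle R n}) : Prop :=
  forall i : 'I_n, f @` subint i = subint (s i) /\
    forall x, subint i x ->
      to_circle n (val (f x) - (s i)%:R / n%:R) =
      to_circle n (val x - i%:R / n%:R) + a i.

Definition Gn : set (sym unit_co) :=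
  [set f | is_iet f /\ exists s a, rotates f s a].

(* The rotation vector of f, which is unique (rotates_inj); zero outside Gn. *)
Definition alpha f : {ffun 'I_n -> circle R n} :=
  xget [ffun=> 0] [set a | exists s, rotates f s a].

Definition An f : circle R n := (\sum_(j < n) alpha f j) *+ 2.

Definition ker_An : set (sym unit_co) := [set f | Gn f /\ An f = 0].

Definition In : set (sym unit_co) := normal_closure_in Gn (involutions Gn).

Section Theory.
Hypothesis n_gt0 : (0 < n)%N.

Let nR : 0 < n%:R :> R. Proof. by rewrite ltr0n. Qed.

Lemma subint_inj (i j : 'I_n) x : subint i x -> subint j x -> i = j.
Proof.
rewrite /subint /= !ler_pdivrMr // !ltr_pdivlMr // => xi xj.
move: xi xj => /andP[i1 i2] /andP[j1 j2]; apply/val_inj => /=.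
have := le_lt_trans i1 j2; have := le_lt_trans j1 i2.
by rewrite !ltr_nat !ltnS => ? ?; apply/eqP; rewrite eqn_leq; apply/andP.
Qed.

Lemma subint_ex x : exists i : 'I_n, subint i x.
Proof.
case: x => x hx; have /andP[x0 x1] := hx.
have y0 : 0 <= x * n%:R by rewrite mulr_ge0 // ltW.
have /andP[l u] := Num.Theory.truncn_itv y0.
have ln : (Num.truncn (x * n%:R)%R < n)%N.
  by rewrite -(ltr_nat R) (le_lt_trans l) // -{2}[n%:R]mul1r ltr_pM2r.
by exists (Ordinal ln); rewrite /subint /= ler_pdivrMr // ltr_pdivlMr // l.
Qed.

Lemma subint_ex0 (i : 'I_n) : exists x, subint i x.
Proof.
have h : 0 <= (i%:R / n%:R : R) < 1.
  by rewrite divr_ge0 ?ler0n //= ltr_pdivrMr // mul1r ltr_nat.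
exists (exist (fun x : R => is_true (0 <= x < 1)) _ h); rewrite /subint /= lexx /=.
by rewrite ltr_pM2r ?invr_gt0 // ltr_nat.
Qed.

Lemma rotates_in f s a i x : rotates f s a -> subint i x -> subint (s i) (f x).
Proof. by move=> /(_ i)[<- _] xi; exists x. Qed.

Lemma rotates_inj f s a s' a' :
  rotates f s a -> rotates f s' a' -> s = s' /\ a = a'.
Proof.
move=> H H'.
have E : s = s'.
  apply/permP => i; have [x xi] := subint_ex0 i.
  exact: subint_inj (rotates_in H xi) (rotates_in H' xi).
subst s'; split=> //; apply/ffunP => i; have [x xi] := subint_ex0 i.
have [_ /(_ x xi) e] := H i; have [_ /(_ x xi)] := H' i.
by rewrite e => /addrI.
Qed.

Lemma alphaE f s a : rotates f s a -> alpha f = a.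
Proof.
move=> H; apply: xget_unique; first by exists s.
by move=> b [s' H']; have [_ ->] := rotates_inj H H'.
Qed.

Lemma rotates1 : rotates 1%g 1%g [ffun=> 0].
Proof.
move=> i; rewrite perm1; split; first exact: image_id.
by move=> x _; rewrite ffunE addr0.
Qed.

Lemma rotatesM f g s a s' a' : rotates f s a -> rotates g s' a' ->
  rotates (f * g)%g (s' * s)%g [ffun i => a' i + a (s' i)].
Proof.
move=> Hf Hg i; rewrite permM; split.
  by have [<- _] := Hf (s' i); have [<- _] := Hg i; rewrite image_comp.
move=> x xi; rewrite ffunE addrA.
have [_ <- //] := Hg i; have [_ <- //] := Hf (s' i).
exact: rotates_in Hg xi.
Qed.

Lemma rotatesV f s a : rotates f s a ->
  rotates f^-1%g s^-1%g [ffun i => - a (s^-1 i)%g].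
Proof.
move=> Hf i.
have Ei : s (s^-1 i)%g = i by rewrite permKV.
have Ii : sym_inv f @` subint i = subint (s^-1 i)%g.
  have [E _] := Hf (s^-1 i)%g; rewrite Ei in E; rewrite -E image_comp.
  rewrite -[RHS]image_id; apply: eq_imagel => x _ /=.
  exact: sym_funK.
split=> // x xi; rewrite ffunE.
have yi : subint (s^-1 i)%g (sym_inv f x) by rewrite -Ii; exists x.
have [_ /(_ _ yi)] := Hf (s^-1 i)%g.
by rewrite Ei sym_invK => ->; rewrite addrK.
Qed.

Lemma to_circle_inj (x y : R) :
  to_circle n x = to_circle n y -> `|x - y| < n%:R^-1 -> x = y.
Proof.
move=> /to_circle_eq[k E]; rewrite E normrM normfV (ger0_norm (ler0n _ _)).
rewrite -{2}[n%:R^-1]mul1r ltr_pM2r ?invr_gt0 // -intr_norm ltrz1 => k1.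
have k0 : k = 0 by lia.
by apply/subr0_eq; rewrite E k0 mul0r.
Qed.

Lemma to_circle_repr (a : circle R n) :
  exists r, to_circle n r = a /\ 0 <= r < n%:R^-1.
Proof.
have [y <-] := to_circle_surj a.
exists (y - (Num.floor (y * n%:R))%:~R / n%:R); split.
  apply/to_circle_eq; exists (- Num.floor (y * n%:R)).
  by rewrite rmorphN /=; ring.
have /andP[l u] := floor_itv (y * n%:R).
rewrite subr_ge0 ltrBlDr -[X in _ < X + _]mul1r -mulrDl.
by rewrite ler_pdivrMr // ltr_pdivlMr // l addrC; move: u; rewrite intrD.
Qed.

Lemma rotates_iet f s a : rotates f s a -> is_iet f.
Proof.
move=> H; have [p Ep] : exists p, n = p.+1 by exists n.-1; lia.
have /choice[r Hr] : forall i, exists r,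
    to_circle n r = a i /\ 0 <= r < n%:R^-1.
  by move=> i; exact: to_circle_repr.
have ip : 0 < n%:R^-1 :> R by rewrite invr_gt0.
pose o k : 'I_n := cast_ord (esym Ep) (inord k).
have oE k : (k < n)%N -> o k = k :> nat.
  by move=> kn; rewrite /= inordK // -Ep.
pose u k : R := if r (o k) == 0 then n%:R^-1 / 2 else n%:R^-1 - r (o k).
have u_itv k : 0 < u k < n%:R^-1.
  have [_ /andP[r0 r1]] := Hr (o k); rewrite /u; case: eqP => [_|/eqP rn0].
    by apply/andP; split; lra.
  have : 0 < r (o k) by rewrite lt_neqAle eq_sym rn0.
  by move=> ?; apply/andP; split; lra.
pose t k : R := k./2%:R / n%:R + (if odd k then u k./2 else 0).
pose c k : R := ((s (o k./2))%:R - k./2%:R) / n%:R + r (o k./2)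
   - (if odd k && (r (o k./2) != 0) then n%:R^-1 else 0).
have tS k : t k.+1 =
    if odd k then k./2.+1%:R / n%:R else k./2%:R / n%:R + u k./2.
  rewrite /t /= uphalf_half; case: (odd k) => /=; last by rewrite add0n.
  by rewrite add1n addr0.
exists n.*2, t, c; split.
- by rewrite /t /= mul0r addr0.
- by rewrite /t doubleK odd_double addr0 divff // gt_eqF.
- move=> k kn; rewrite tS /t; have /andP[u0 u1] := u_itv k./2.
  by case: (odd k); rewrite -?natr1 ?mulrDl ?mul1r; lra.
move=> k x kn; rewrite tS => Hx.
have k2 : (k./2 < n)%N by lia.
have /andP[u0 u1] := u_itv k./2.
have xi : subint (o k./2) x.
  rewrite /subint /mkset oE //; move: Hx; rewrite /t.
  move: (val x) => v; rewrite -natr1 mulrDl mul1r.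
  by case: (odd k) => /andP[? ?]; apply/andP; split; lra.
have [_ /(_ x xi)] := H (o k./2).
have [<- rb] := Hr (o k./2); rewrite -to_circleD => e.
have := rotates_in H xi; move: xi; rewrite /subint /mkset.
rewrite -!natr1 !(mulrDl, mul1r) (oE _ k2) => xb fb.
have ce (b : bool) (v : R) : v = val x - k./2%:R / n%:R + r (o k./2)
     - (if b then n%:R^-1 else 0) -> to_circle n v =
    to_circle n (val x - k./2%:R / n%:R + r (o k./2)).
  move=> ->; apply/to_circle_eq; exists (if b then -1 else 0).
  by case: b; rewrite ?mul0r ?rmorphN /= ?mulN1r ?mul1r; ring.
set b := odd k && (r (o k./2) != 0).
rewrite (oE _ k2) in e; rewrite -(ce b _ erefl) in e.
have E := to_circle_inj e.
suff /E : `|val (f x) - (s (o k./2))%:R / n%:R -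
    (val x - k./2%:R / n%:R + r (o k./2) - (if b then n%:R^-1 else 0))|
    < n%:R^-1.
  rewrite /c -/b mulrBl => F; lra.
move: Hx; rewrite ltr_norml /t /b /u.
move: (val x) (val (f x)) xb fb rb {e E ce} => v w xb fb rb.
case: eqP => [->|_]; case: (odd k) => /=; rewrite -?natr1 ?(mulrDl, mul1r);
  move: xb fb rb => /andP[? ?] /andP[? ?] /andP[? ?] /andP[? ?];
  by apply/andP; split; lra.
Qed.

Lemma Gn_subgroup : subgroup Gn.
Proof.
split=> [|f g].
  rewrite inE; split; first exact: rotates_iet rotates1.
  by exists 1%g, [ffun=> 0]; exact: rotates1.
rewrite !inE => -[_ [s [a Hf]]] [_ [s' [a' Hg]]].
have H := rotatesM Hf (rotatesV Hg).
by split; [exact: rotates_iet H|do 2 eexists; exact: H].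
Qed.

Lemma AnM f g : Gn f -> Gn g -> An (f * g)%g = An f + An g.
Proof.
move=> [_ [s [a Hf]]] [_ [s' [a' Hg]]].
rewrite /An (alphaE (rotatesM Hf Hg)) (alphaE Hf) (alphaE Hg) -mulrnDl.
congr (_ *+ 2); under eq_bigr do rewrite ffunE.
by rewrite big_split /= addrC; congr (_ + _); rewrite [RHS](reindex_perm s').
Qed.

End Theory.
End IET.

Arguments Gn R n : clear implicits.
Arguments ker_An R n : clear implicits.
Arguments In R n : clear implicits.

(* Main.v *)
Require Import Defs.
From mathcomp Require Import all_boot all_order fingroup perm all_algebra.
From mathcomp Require Import lra zify.
From mathcomp Require Import boolp classical_sets reals.

(* An element of G_n is determined by its permutation s and its rotation vector
   a, and every pair (s, a) occurs, so G_n is the wreath product of the circle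
   with S_n.  It is an involution iff s^2 = 1 and a (s i) = - a i, which forces
   2 sum a = 0.  Conversely let 2 sum a = 0.  Over the n-cycle c, the element
   (c, a) is a product of two involutions lying above two reflections of Z/n;
   and c^-1 s, like every permutation, is a product of two involutions of S_n,
   which lift with zero rotation.  Hence (s, a) is a product of four.  For the
   last claim an element with A(f) != 0 suffices: it is not a product of any
   number of involutions. *)

Local Open Scope classical_set_scope.
Local Open Scope ring_scope.

Import Order.TTheory GRing.Theory Num.Theory.

(* Reflect each orbit of s about a chosen root z: s^k z |-> s^-k z. *)
Lemma perm_prod_involutions {T : finType} (s : {perm T}) :
  exists t u : {perm T}, [/\ (t * t = 1)%g, (u * u = 1)%g & (s = t * u)%g].
Proof.
pose r x := odflt x [pick y in porbit s x].
have rP x : exists2 g, g \in <[s]>%g & x = g (r x).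
  rewrite /r; case: pickP => [y yx|/(_ x)]; last by rewrite porbit_id.
  move: yx; rewrite porbit_sym porbit.unlock => /imsetP[g gs ->].
  by exists g.
have rE g x : g \in <[s]>%g -> r (g x) = r x.
  move=> /cycleP[i ->]; rewrite /r porbit_perm.
  by case: pickP => // /(_ x); rewrite porbit_id.
have comm g h : g \in <[s]>%g -> h \in <[s]>%g -> (g * h = h * g)%g.
  by move=> /cycleP[i ->] /cycleP[j ->]; rewrite -!expgD addnC.
have /choice[t tP] : forall x, exists y,
    exists g, [/\ g \in <[s]>%g, x = g (r x) & y = (g^-1)%g (r x)].
  by move=> x; have [g gs e] := rP x; exists ((g^-1)%g (r x)), g.
have tE g x : g \in <[s]>%g -> t (g (r x)) = (g^-1)%g (r x).
  move=> gs; have [h [hs]] := tP (g (r x)).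
  have -> : r (g (r x)) = r x.
    by rewrite rE //; have [k ks {2}->] := rP x; rewrite rE.
  move=> e ->; apply: (@perm_inj _ g); rewrite permKV.
  apply: (@perm_inj _ h); rewrite -[g _]permM -permM.
  rewrite -mulgA (comm g h) // mulKg.
  exact: e.
have tK : involutive t.
  move=> x; have [g [gs e ->]] := tP x.
  by rewrite tE ?groupV // invgK -e.
have stK : involutive (t \o s).
  move=> x /=; have [g gs e] := rP x.
  have ss := cycle_id s.
  have -> : s x = (g * s)%g (r x) by rewrite permM -e.
  rewrite tE ?groupM // -permM.
  by rewrite (comm g s) // invMg mulgKV tE ?groupV // invgK -e.
pose p := perm (can_inj tK).
exists (s * p)%g, p; split.
- by apply/permP => x; rewrite !permM !permE; exact: stK.
- by apply/permP => x; rewrite !permM !permE tK.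
- by apply/permP => x; rewrite !permM !permE tK.
Qed.

Section Wreath.
Context {R : realType} {n : nat} (n_gt0 : (0 < n)%N).
Implicit Types (s : 'S_n) (a b : {ffun 'I_n -> circle R n}) (f g : sym (unit_co R)).

Definition rotated s a (x y : unit_co R) : Prop :=
  forall i : 'I_n, subint i x -> subint (s i) y /\
    to_circle n (val y - (s i)%:R / n%:R) =
    to_circle n (val x - i%:R / n%:R) + a i.

Lemma subint_offset {i : 'I_n} {x : unit_co R} :
  subint i x -> 0 <= val x - i%:R / n%:R < n%:R^-1.
Proof.
rewrite /subint /mkset -natr1 mulrDl mul1r => /andP[? ?].
by rewrite subr_ge0 ltrBlDl; apply/andP.
Qed.

Lemma rotated_unique {s a x y z} : rotated s a x y -> rotated s a x z -> y = z.
Proof.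
have [i xi] := subint_ex n_gt0 x => /(_ i xi)[yi ey] /(_ i xi)[zi].
rewrite -ey => /esym/(to_circle_inj n_gt0) E; apply/val_inj.
have /andP[? ?] := subint_offset yi; have /andP[? ?] := subint_offset zi.
apply: (addIr (- ((s i)%:R / n%:R))); apply: E.
by rewrite ltr_norml; apply/andP; split; lra.
Qed.

Lemma rotated_ex s a x : exists y, rotated s a x y.
Proof.
have [i xi] := subint_ex n_gt0 x.
have [r [er /andP[r0 r1]]] :=
  to_circle_repr n_gt0 (to_circle n (val x - i%:R / n%:R) + a i).
have nR : 0 < n%:R :> R by rewrite ltr0n.
have hu : (s i)%:R / n%:R + n%:R^-1 <= 1 :> R.
  rewrite -[X in _ + X <= _]mul1r -mulrDl ler_pdivrMr // mul1r natr1 ler_nat.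
  exact: ltn_ord.
have hl : 0 <= (s i)%:R / n%:R :> R by rewrite divr_ge0 // ler0n.
have hy : 0 <= (s i)%:R / n%:R + r < 1 by apply/andP; split; lra.
exists (exist (fun x : R => is_true (0 <= x < 1)) _ hy) => j xj.
have <- : i = j := subint_inj n_gt0 xi xj.
rewrite /subint /mkset /= -er -natr1 mulrDl mul1r; split; last first.
  by congr to_circle; lra.
by apply/andP; split; lra.
Qed.

Lemma rotatedV {s a x y} : rotated s a x y ->
  rotated s^-1%g [ffun i => - a (s^-1 i)%g] y x.
Proof.
have [i xi] := subint_ex n_gt0 x => /(_ i xi)[yi ey] j yj.
have <- : s i = j := subint_inj n_gt0 yi yj.
by rewrite ffunE permK; split=> //; rewrite ey addrK.
Qed.

Lemma rotates_rotated {f s a} : rotates f s a <-> forall x, rotated s a x (f x).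
Proof.
split=> [H x i xi|H i].
  by split; [exact: rotates_in H xi | have [_ /(_ _ xi)] := H i].
split=> [|x /(H x)[]//]; rewrite eqEsubset; split=> [_ [x /(H x)[xi _] <-]//|y yi].
have Ex := rotatedV (H (sym_inv f y)).
exists (sym_inv f y); rewrite ?sym_invK //.
move: Ex => /(_ (s i)); rewrite sym_invK => /(_ yi)[]; by rewrite permK.
Qed.

Lemma rotates_unique {f g s a} : rotates f s a -> rotates g s a -> f = g.
Proof.
move=> /rotates_rotated Hf /rotates_rotated Hg; apply: symP => x.
exact: rotated_unique (Hf x) (Hg x).
Qed.

Lemma rotates_ex s a : exists f, rotates f s a.
Proof.
have [f Hf] := choice (rotated_ex s a).
have [g Hg] := choice (rotated_ex s^-1%g [ffun i => - a (s^-1 i)%g]).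
have fK : cancel f g.
  by move=> x; apply: rotated_unique (Hg _) (rotatedV (Hf x)).
have gK : cancel g f.
  move=> x; have := rotatedV (Hg x).
  have -> : [ffun i => - [ffun i => - a (s^-1 i)%g] ((s^-1)^-1 i)%g] = a.
    by apply/ffunP => i; rewrite !ffunE invgK permK opprK.
  by rewrite invgK => H; exact: rotated_unique (Hf _) H.
by exists (Defs.Sym fK gK); apply/rotates_rotated.
Qed.

Lemma rotates_Gn {f s a} : rotates f s a -> Gn R n f.
Proof. by move=> H; split; [exact: rotates_iet H | exists s, a]. Qed.

Lemma rotates_involution {f s a} : rotates f s a ->
  involutions (Gn R n) f <-> (s * s = 1)%g /\ forall i, a (s i) = - a i.
Proof.
move=> H; have HH := rotatesM H H; split=> [[_ ff]|[ss as_]].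
  rewrite ff in HH; have [<- /ffunP E] := rotates_inj n_gt0 (@rotates1 R n) HH.
  split=> // i; move: (E i); rewrite !ffunE => /esym/eqP.
  by rewrite addrC addr_eq0 => /eqP.
split; first exact: rotates_Gn H.
apply: rotates_unique HH _; rewrite ss.
have -> : [ffun i => a i + a (s i)] = [ffun=> 0] :> {ffun 'I_n -> circle R n}.
  by apply/ffunP => i; rewrite !ffunE as_ subrr.
exact: rotates1.
Qed.

Lemma involution_An {f} : involutions (Gn R n) f -> An n f = 0.
Proof.
move=> If; have [[_ [s [a H]]] _] := If.
have [_ as_] := (rotates_involution H).1 If.
rewrite /An (alphaE n_gt0 H) mulr2n {1}(reindex_perm s) -big_split big1 //= => i _.
by rewrite as_ addNr.
Qed.

(* The antisymmetric vectors are differences of partial sums P of a: with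
   b i = P (n - i) - P i on the reflection i |-> -i (mod n), and
   b i = P (n - 1 - i) - P i on i |-> n - 1 - i.  Only the value b 0 = P n of
   the former at its fixed point 0 requires P n to be 2-torsion. *)
Lemma rotation_prod_involutions {a} : (\sum_i a i) *+ 2 = 0 ->
  exists (c : 'S_n) f g, [/\ involutions (Gn R n) f, involutions (Gn R n) g &
    rotates (f * g)%g c a].
Proof.
move=> a2.
have negP (i : 'I_n) : ((n - i) %% n < n)%N by rewrite ltn_pmod.
pose neg (i : 'I_n) : 'I_n := Ordinal (negP i).
have neg0 (i : 'I_n) : i = 0%N :> nat -> neg i = i :> nat.
  by move=> /= ->; rewrite subn0 modnn.
have negN0 (i : 'I_n) : (0 < i)%N -> neg i = (n - i)%N :> nat.
  by move=> i0 /=; rewrite modn_small //; have := ltn_ord i; lia.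
have negK : involutive neg.
  move=> i; apply/ord_inj; have := ltn_ord i.
  case: (posnP i) => [i0|i0] lt_in; first by rewrite !neg0.
  by rewrite (negN0 (neg i)) (negN0 i) //; lia.
pose P k : circle R n := \sum_(i < n | (i < k)%N) a i.
have Pn : P n *+ 2 = 0.
  by rewrite -[RHS]a2 /P; congr (_ *+ 2); apply: eq_bigl => i; rewrite ltn_ord.
have P0 : P 0%N = 0 by rewrite /P big_pred0.
have PS (i : 'I_n) : P i.+1 = P i + a i.
  rewrite /P (bigD1 i) //= addrC; congr (_ + _); apply: eq_bigl => j.
  by rewrite ltnS ltn_neqAle andbC.
pose t1 := perm (can_inj negK); pose t2 := perm (@rev_ord_inj n).
pose b1 := [ffun i : 'I_n => P (n - i)%N - P i].
pose b2 := [ffun i : 'I_n => P (n - i.+1)%N - P i].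
have [f Hf] := rotates_ex t1 b1; have [g Hg] := rotates_ex t2 b2.
exists (t2 * t1)%g, f, g; split.
- apply/(rotates_involution Hf); split.
    by apply/permP => i; rewrite permM !permE negK.
  move=> i; rewrite !ffunE permE opprB.
  case: (posnP i) => [i0|i0].
    rewrite neg0 // i0 subn0 P0 subr0 sub0r; apply/eqP.
    by rewrite -addr_eq0 -mulr2n Pn.
  by rewrite negN0 // subKn // ltnW.
- apply/(rotates_involution Hg); split.
    by apply/permP => i; rewrite permM !permE rev_ordK.
  move=> i; rewrite !ffunE permE opprB /=.
  by congr (P _ - P _); have := ltn_ord i; lia.
- have := rotatesM Hf Hg; congr rotates; apply/ffunP => i; rewrite !ffunE permE /=.
  have -> : (n - (n - i.+1) = i.+1)%N by have := ltn_ord i; lia.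
  by rewrite PS addrC addrA subrK addrAC subrr add0r.
Qed.

Lemma prod4_involutions f : Gn R n f -> An n f = 0 ->
  prod_involutions (Gn R n) 4 f.
Proof.
move=> [_ [s [a H]]]; rewrite /An (alphaE n_gt0 H) => a2.
have [c [f3 [f4 [I3 I4 H34]]]] := rotation_prod_involutions a2.
have [u [v [uu vv Euv]]] := perm_prod_involutions (c^-1 * s)%g.
have [f1 H1] := rotates_ex v [ffun=> 0].
have [f2 H2] := rotates_ex u [ffun=> 0].
exists (fun i : 'I_4 => nth 1%g [:: f1; f2; f3; f4] i); split.
  have I1 : involutions (Gn R n) f1.
    by apply/(rotates_involution H1); split=> // i; rewrite !ffunE oppr0.
  have I2 : involutions (Gn R n) f2.
    by apply/(rotates_involution H2); split=> // i; rewrite !ffunE oppr0.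
  by case=> [[|[|[|[|]]]]].
rewrite !big_ord_recl big_ord0 mulg1 /= mulgA.
apply: rotates_unique H _; have := rotatesM (rotatesM H1 H2) H34.
rewrite -Euv mulKVg; congr rotates.
by apply/ffunP => i; rewrite !ffunE !addr0.
Qed.

Lemma ker_An_normal : normal_in (Gn R n) (ker_An R n).
Proof.
have [G1 GB] := @Gn_subgroup R n n_gt0.
have An1 : An n (1%g : sym (unit_co R)) = 0.
  by rewrite /An (alphaE n_gt0 (@rotates1 R n)) big1 ?mul0rn // => i _; rewrite ffunE.
rewrite inE in G1.
have GV g : Gn R n g -> Gn R n g^-1%g.
  by move=> Gg; have := GB 1%g g; rewrite !inE mul1g; apply.
have GM g h : Gn R n g -> Gn R n h -> Gn R n (g * h)%g.
  by move=> Gg /GV Gh; have := GB g h^-1%g; rewrite !inE invgK; apply.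
have AV g : Gn R n g -> An n g^-1%g = - An n g.
  by move=> Gg; apply/eqP; rewrite -addr_eq0 -AnM // ?mulVg ?An1 //; exact: GV.
split=> [|f []//|g h Gg [Gh h0]].
  split=> [|f g]; first by rewrite inE.
  rewrite !inE => -[Gf f0] [Gg g0]; split; first exact/GM/GV.
  by rewrite AnM ?AV // ?f0 ?g0 ?subr0 //; exact: GV.
split; first exact: (GM) (GM _ _ Gg Gh) (GV _ Gg).
by rewrite (AnM n_gt0 (GM _ _ Gg Gh) (GV _ Gg)) AnM // AV // h0 addr0 subrr.
Qed.

Lemma prod_involutions_In k f : prod_involutions (Gn R n) k f -> In R n f.
Proof.
move=> [t [It ->]] H [[H1 HB] _ _] IH.
have HM := group_closedM (conj H1 HB).
apply: (big_ind H) => [|x y Hx Hy|i _]; last exact/IH/It.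
  by move: H1; rewrite inE.
by have := HM x y; rewrite !inE; apply.
Qed.

Lemma ker_An_In : ker_An R n = In R n.
Proof.
rewrite eqEsubset; split=> f.
  by move=> [Gf f0]; apply: (@prod_involutions_In 4); exact: prod4_involutions.
apply; first exact: ker_An_normal.
by move=> g Ig; split; [case: Ig | exact: involution_An].
Qed.

Lemma An_neq0_ex : exists2 f, Gn R n f & An n f <> 0.
Proof.
pose a : {ffun 'I_n -> circle R n} :=
  [ffun i => if i == Ordinal n_gt0 then to_circle n (n%:R^-1 / 4) else 0].
have [f Hf] := rotates_ex 1%g a; exists f; first exact: rotates_Gn Hf.
rewrite /An (alphaE n_gt0 Hf) (bigD1 (Ordinal n_gt0)) //= big1 => [|i /negPf ni].
  rewrite ffunE eqxx addr0 mulr2n -to_circleD => E.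
  have nV : 0 < n%:R^-1 :> R by rewrite invr_gt0 ltr0n.
  have : n%:R^-1 / 4 + n%:R^-1 / 4 = 0 :> R.
    apply: (to_circle_inj n_gt0); last by rewrite ltr_norml; apply/andP; split; lra.
    by rewrite E; apply: (addrI (to_circle n 0)); rewrite -to_circleD !addr0.
  by lra.
by rewrite ffunE ni.
Qed.

End Wreath.

Theorem corollary2 (R : realType) (n : nat) (n_gt0 : (0 < n)%N) :
  [/\ ker_An R n = In R n,
      (forall f : sym (unit_co R), In R n f ->
         exists2 k, (k <= 4)%N & prod_involutions (Gn R n) k f)
    & ((3 <= n)%N -> exists f : sym (unit_co R),
         Gn R n f /\ ~ prod_involutions (Gn R n) 3 f)].
Proof.
split=> [|f|_]; first exact: ker_An_In.
  by rewrite -ker_An_In // => -[Gf f0]; exists 4%N; last exact: prod4_involutions.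
have [f Gf f0] := @An_neq0_ex R n n_gt0; exists f; split=> // /prod_involutions_In.
by rewrite -ker_An_In // => -[].
Qed.
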